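(* Let $(A,\cdot_A)$ be a commutative algebra with an averaging operator $P:A\to A$, and let $(A,\circ_A)$ be the induced perm algebra given by $x\circ_A y=P(x)\cdot_A y$ for all $x,y\in A$. If there is an invariant bilinear form $\mathcal B$ on $(A,\cdot_A)$, then $\mathcal B$ is left-invariant on $(A,\circ_A)$ in the sense that $$\mathcal B(x\circ_A y,z)=\mathcal B(y,x\circ_A z),\qquad\forall x,y,z\in A.$$
   Context: All vector spaces and algebras are finite-dimensional over an algebraically closed field $\mathbb K$ of characteristic zero; ''commutative algebra'' means commutative associative algebra. An averaging operator on $(A,\cdot_A)$ is a linear map $P:A\to A$ with $P(x)\cdot_A P(y)=P(P(x)\cdot_A y)$ for all $x,y$. A bilinear form $\mathcal B$ on $(A,\cdot_A)$ is invariant if $\mathcal B(x\cdot_A y,z)=\mathcal B(x,y\cdot_A z)$ for all $x,y,z$. A perm algebra $(A,\circ_A)$ satisfies $x\circ_A(y\circ_A z)=(x\circ_A y)\circ_A z=(y\circ_A x)\circ_A z$; it is known that $x\circ_A y=P(x)\cdot_A y$ defines one. *)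

(* Defs.v *)
From HB Require Import structures.
From mathcomp Require Import all_boot all_order all_algebra.

Set Implicit Arguments.
Unset Strict Implicit.
Unset Printing Implicit Defensive.

Import GRing.Theory.
Local Open Scope ring_scope.

(* MathComp's algebra structures all carry a unit element, which is not assumed
   here, so products are bilinear maps on a finite-dimensional vector space. *)

Record comm_algebra (K : fieldType) (A : vectType K) := CommAlgebra {
  comm_mul :> {bilinear A -> A -> A};
  comm_mulC : commutative comm_mul;
  comm_mulA : associative comm_mul
}.

Record perm_algebra (K : fieldType) (A : vectType K) := PermAlgebra {
  perm_mul :> {bilinear A -> A -> A};
  perm_mulA : associative perm_mul;
  perm_mulCl : forall x y z : A,
    perm_mul (perm_mul x y) z = perm_mul (perm_mul y x) z
}.

Definition averaging_operator (K : fieldType) (A : vectType K)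
    (mu : comm_algebra A) (P : {linear A -> A}) : Prop :=
  forall x y : A, mu (P x) (P y) = P (mu (P x) y).

Definition invariant_form (K : fieldType) (A : vectType K)
    (mu : comm_algebra A) (B : {biscalar A}) : Prop :=
  forall x y z : A, B (mu x y) z = B x (mu y z).

Definition left_invariant_form (K : fieldType) (A : vectType K)
    (nu : perm_algebra A) (B : {biscalar A}) : Prop :=
  forall x y z : A, B (nu x y) z = B y (nu x z).

Section InducedPerm.

Variables (K : fieldType) (A : vectType K).
Variables (mu : comm_algebra A) (P : {linear A -> A}).

Definition induced_mul (x y : A) : A := mu (P x) y.

Lemma induced_mul_is_bilinear :
  bilinear_for (GRing.Scale.Law.clone _ _ *:%R _)
               (GRing.Scale.Law.clone _ _ *:%R _) induced_mul.
Proof.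
split=> [u a x y | u a x y]; rewrite /induced_mul.
  by rewrite linearP linearPl.
by rewrite linearPr.
Qed.

HB.instance Definition _ :=
  bilinear_isBilinear.Build K A A A _ _ induced_mul induced_mul_is_bilinear.

Hypothesis avgP : averaging_operator mu P.

Lemma induced_mulA : associative induced_mul.
Proof. by move=> x y z; rewrite /induced_mul -avgP comm_mulA. Qed.

Lemma induced_mulCl (x y z : A) :
  induced_mul (induced_mul x y) z = induced_mul (induced_mul y x) z.
Proof. by rewrite /induced_mul -!avgP (comm_mulC mu (P x)). Qed.

Definition induced_perm_algebra : perm_algebra A :=
  @PermAlgebra K A induced_mul induced_mulA induced_mulCl.

End InducedPerm.

(* Main.v *)
Require Import Defs.
From mathcomp Require Import all_boot all_order all_algebra.
Set Implicit Arguments.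
Unset Strict Implicit.
Unset Printing Implicit Defensive.
Local Open Scope ring_scope.

(** Left multiplication by [x] in the perm algebra is multiplication by [P x] in
    the commutative algebra; by commutativity it is also multiplication on the
    right, and invariance then moves [P x] to the other argument of [B]. *)
Theorem proposition3p1 (K : closedFieldType) (charK0 : [pchar K] =i pred0)
    (A : vectType K) (mu : comm_algebra A)
    (P : {linear A -> A}) (avgP : averaging_operator mu P)
    (B : {biscalar A}) (invB : invariant_form mu B) :
  left_invariant_form (induced_perm_algebra avgP) B.
Proof.
move=> x y z.
change (B (mu (P x) y) z = B y (mu (P x) z)).
by rewrite (comm_mulC mu (P x) y) invB.
Qed.
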